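(* Let $\Gamma$ be a group, $\gamma\in\Gamma$, and let $R$ be a $\Gamma$-graded ring, $\sigma$ a ring endomorphism of $R$ and $\delta$ a $\sigma$-derivation such that $(\sigma,\delta)$ is $\gamma$-compatible. Let $A=R[t;\sigma,\delta]$, graded with $\deg t=\gamma$. Assume that $R$ is gr-simple and that $\sigma$ is an automorphism. \begin{enumerate} \item[(1)] $A$ is gr-simple if and only if $A$ contains no homogeneous normal element that is monic of positive $t$-degree. \item[(2)] If $\Delta_n=\sum_{j=0}^{n-1}\sigma^j\delta\sigma^{-j}$ is outer for every $n\ge1$, then $A$ is gr-simple. \item[(3)] If $\operatorname{char}R=0$ and $\sigma\delta\sigma^{-1}-\delta$ is inner, then $A$ is gr-simple if and only if $\delta$ is outer. \end{enumerate}
   Context: Rings are associative with identity and nonzero; ring homomorphisms preserve the identity; ideals are two-sided. $\operatorname{char}R=0$ means $n1_R\neq0$ for every integer $n\ge1$. A $\sigma$-derivation is an additive map $\delta\colon R\to R$ with $\delta(rs)=\delta(r)s+\sigma(r)\delta(s)$. The Ore extension $R[t;\sigma,\delta]$ is the free left $R$-module with basis $1,t,t^2,\dots$ with multiplication determined by $tr=\sigma(r)t+\delta(r)$ for $r\in R$. The group $\Gamma$ is not necessarily abelian. A $\Gamma$-graded ring is $R=\bigoplus_{\tau\in\Gamma}R_\tau$ (additive subgroups) with $R_\rho R_\tau\subseteq R_{\rho\tau}$; elements of $R_\tau$ are homogeneous of degree $\tau$. The pair $(\sigma,\delta)$ is $\gamma$-compatible if $\sigma(R_\tau)\subseteq R_{\gamma\tau\gamma^{-1}}$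 and $\delta(R_\tau)\subseteq R_{\gamma\tau}$ for all $\tau\in\Gamma$. Then $A$ carries the $\Gamma$-grading $A_\alpha=\bigoplus_{n\ge0}R_{\alpha\gamma^{-n}}t^n$ ($\alpha\in\Gamma$). An ideal is graded if it is generated by homogeneous elements; a graded ring is gr-simple if $0$ and the ring itself are its only graded ideals. For $u\in R$, $\delta_u(r)=ur-\sigma(r)u$ is a $\sigma$-derivation. A $\sigma$-derivation is inner if it equals $\delta_u$ for some $u\in R$, and outer otherwise. Since $\sigma$ is an automorphism, each $\sigma^j\delta\sigma^{-j}$ is a $\sigma$-derivation, hence so is $\Delta_n$. An element $f$ of a ring $S$ is normal if $Sf=fS$. An element of $A$ is monic of $t$-degree $n$ (where $n\geq 1$) if it has the form $t^n+\sum_{i<n}a_it^i$ with $a_i\in R$. *)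

(* Defs.v *)
From HB Require Import structures.
From mathcomp Require Import all_boot all_order all_algebra.
From mathcomp Require Import boolp classical_sets.

Set Implicit Arguments.
Unset Strict Implicit.
Unset Printing Implicit Defensive.

Import GRing.Theory.
Local Open Scope ring_scope.
Local Open Scope classical_set_scope.

Definition char0 (R : nzRingType) : Prop :=
  forall n : nat, (0 < n)%N -> n%:R != 0 :> R.

Definition two_sided_ideal (S : nzRingType) (I : set S) : Prop :=
  [/\ I 0, forall x y, I x -> I y -> I (x - y),
      forall a x, I x -> I (a * x) & forall a x, I x -> I (x * a)].

Definition normal_elt (S : nzRingType) (f : S) : Prop :=
  range (fun s => s * f) = range (fun s => f * s).

Section Gradings.
Variables (G : groupType) (S : nzRingType).
Implicit Types (comp : G -> set S).

(* gr_span and gr_indep say that S is the internal direct sum of the comp g. *)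
Record is_grading comp : Prop := IsGrading {
  gr_zmod : forall g, comp g 0 /\
    (forall x y, comp g x -> comp g y -> comp g (x - y));
  gr_span : forall x, exists (s : seq G) (f : G -> S),
    (forall g, comp g (f g)) /\ x = \sum_(g <- s) f g;
  gr_indep : forall (s : seq G) (f : G -> S), uniq s ->
    (forall g, comp g (f g)) -> \sum_(g <- s) f g = 0 ->
    forall g, g \in s -> f g = 0;
  gr_mul : forall g h x y, comp g x -> comp h y -> comp (g * h)%g (x * y)
}.

Definition homogeneous comp (x : S) : Prop := exists g, comp g x.

Definition graded_ideal comp (I : set S) : Prop :=
  exists2 X : set S, X `<=` homogeneous comp &
    I = smallest (@two_sided_ideal S) X.

Definition gr_simple comp : Prop :=
  forall I, graded_ideal comp I -> I = [set 0] \/ I = setT.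

End Gradings.

Section SkewDerivations.
Variables (R : nzRingType) (sigma : {rmorphism R -> R}).

Record skew_derivation := SkewDerivation {
  skew_der_fun :> {additive R -> R};
  skew_derM : forall r s,
    skew_der_fun (r * s) = skew_der_fun r * s + sigma r * skew_der_fun s
}.

(* Both notions are only applied to functions that are sigma-derivations. *)
Definition inner_der (d : R -> R) : Prop :=
  exists u : R, forall r, d r = u * r - sigma r * u.

Definition outer_der (d : R -> R) : Prop := ~ inner_der d.

Definition compatible (G : groupType) (gamma : G) (comp : G -> set R)
    (delta : R -> R) : Prop :=
  forall tau r, comp tau r ->
    comp (gamma * tau * gamma^-1)%g (sigma r) /\
    comp (gamma * tau)%g (delta r).

(* sigmaV stands for the inverse of sigma. *)
Definition Delta (sigmaV delta : R -> R) (n : nat) (r : R) : R :=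
  \sum_(j < n) iter j sigma (delta (iter j sigmaV r)).

End SkewDerivations.

(* R[t; sigma, delta]: the polynomial \sum_i a_i *: 'X^i stands for
   \sum_i a_i t^i; the left R-module structure is that of {poly R}, and the
   product is ore_mul below, the one determined by ore_comm. *)
Definition ore (R : nzRingType) (sigma : {rmorphism R -> R})
  (delta : skew_derivation sigma) : Type := {poly R}.

Section OreExtension.
Variables (R : nzRingType) (sigma : {rmorphism R -> R}).
Variable delta : skew_derivation sigma.
Implicit Types (p q : {poly R}).

(* Left multiplication by t: t (a t^i) = sigma(a) t^(i+1) + delta(a) t^i. *)
Definition ore_shift p : {poly R} := map_poly sigma p * 'X + map_poly delta p.

Lemma coef_ore_shift p n :
  (ore_shift p)`_n = (if n is m.+1 then sigma p`_m else 0) + delta p`_n.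
Proof. by rewrite coefD coefMX !coef_map; case: n. Qed.

Lemma ore_shiftD : {morph ore_shift : p q / p + q}.
Proof. by move=> p q; rewrite /ore_shift !raddfD /= mulrDl addrACA. Qed.

Lemma ore_shift0 : ore_shift 0 = 0.
Proof. by rewrite /ore_shift !raddf0 mul0r addr0. Qed.

Lemma ore_shift_sum I (r : seq I) (F : I -> {poly R}) :
  ore_shift (\sum_(i <- r) F i) = \sum_(i <- r) ore_shift (F i).
Proof. exact: (big_morph _ ore_shiftD ore_shift0). Qed.

Lemma ore_shiftZ a p :
  ore_shift (a *: p) = sigma a *: ore_shift p + delta a *: p.
Proof.
apply/polyP => n; rewrite coef_ore_shift coefD !coefZ coef_ore_shift skew_derM.
case: n => [|n]; first by rewrite !add0r addrC.
by rewrite /= coefZ rmorphM mulrDr addrA addrAC.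
Qed.

Lemma iter_ore_shiftD i : {morph iter i ore_shift : p q / p + q}.
Proof. by move=> p q; elim: i => //= i ->; rewrite ore_shiftD. Qed.

Lemma iter_ore_shift0 i : iter i ore_shift 0 = 0.
Proof. by elim: i => //= i ->; rewrite ore_shift0. Qed.

Lemma iter_ore_shift1 i : iter i ore_shift 1 = 'X^i.
Proof.
elim: i => [|i IH]; rewrite ?expr0 // iterS {}IH.
have d1 : delta 1 = 0.
  apply: (addIr (delta 1)); rewrite add0r -{3}[1]mulr1 skew_derM.
  by rewrite rmorph1 mulr1 mul1r.
rewrite /ore_shift map_polyXn exprSr -[RHS]addr0; congr (_ + _).
by apply/polyP => n; rewrite coef_map coefXn coef0; case: eqP; rewrite ?raddf0.
Qed.

Definition ore_mul p q : {poly R} :=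
  \sum_(i < size p) p`_i *: iter i ore_shift q.

Lemma ore_mul_wide n p q : (size p <= n)%N ->
  ore_mul p q = \sum_(i < n) p`_i *: iter i ore_shift q.
Proof.
move=> le_pn; rewrite /ore_mul.
rewrite (big_ord_widen _ (fun i : nat => p`_i *: iter i ore_shift q) le_pn).
rewrite big_mkcond; apply: eq_bigr => i _ /=.
by case: ltnP => // /(nth_default 0) ->; rewrite scale0r.
Qed.

Lemma ore_mulDl : left_distributive ore_mul +%R.
Proof.
move=> p q r; set n := maxn (size p) (size q).
rewrite !(@ore_mul_wide n) ?leq_maxl ?leq_maxr ?size_polyD //.
by rewrite -big_split; apply: eq_bigr => i _; rewrite coefD scalerDl.
Qed.

Lemma ore_mulDr : right_distributive ore_mul +%R.
Proof.
move=> p q r; rewrite -big_split; apply: eq_bigr => i _.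
by rewrite iter_ore_shiftD scalerDr.
Qed.

Lemma ore_mul0l q : ore_mul 0 q = 0.
Proof. by rewrite /ore_mul size_poly0 big_ord0. Qed.

Lemma ore_mul_suml I (s : seq I) (F : I -> {poly R}) q :
  ore_mul (\sum_(i <- s) F i) q = \sum_(i <- s) ore_mul (F i) q.
Proof.
by apply: (big_morph (ore_mul^~ q)) => [p p'|]; rewrite ?ore_mulDl ?ore_mul0l.
Qed.

Lemma ore_mulZl a p q : ore_mul (a *: p) q = a *: ore_mul p q.
Proof.
rewrite (@ore_mul_wide (size p)) ?size_scale_leq // scaler_sumr.
by apply: eq_bigr => i _; rewrite coefZ scalerA.
Qed.

Lemma ore_mul_shift p q : ore_mul (ore_shift p) q = ore_shift (ore_mul p q).
Proof.
have le_s : (size (ore_shift p) <= (size p).+1)%N.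
  apply/leq_sizeP => -[//|n] lt_pn; rewrite coef_ore_shift.
  by rewrite !nth_default ?raddf0 ?addr0 // leqW.
rewrite (ore_mul_wide _ le_s) ore_shift_sum.
under eq_bigr do rewrite coef_ore_shift scalerDl.
rewrite big_split big_ord_recl /= scale0r add0r big_ord_recr /=.
rewrite [p`_(size p)]nth_default // raddf0 scale0r addr0 -big_split.
apply: eq_bigr => i _.
by rewrite ore_shiftZ.
Qed.

Lemma ore_mul_iter i p q :
  ore_mul (iter i ore_shift p) q = iter i ore_shift (ore_mul p q).
Proof. by elim: i => //= i <-; rewrite ore_mul_shift. Qed.

Lemma ore_mulA : associative ore_mul.
Proof.
move=> p q r; rewrite [ore_mul p q]/ore_mul ore_mul_suml; apply: eq_bigr => i _.
by rewrite ore_mulZl ore_mul_iter.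
Qed.

Lemma ore_mul1l : left_id 1 ore_mul.
Proof. by move=> p; rewrite /ore_mul size_poly1 big_ord1 coefC scale1r. Qed.

Lemma ore_mul1r : right_id 1 ore_mul.
Proof.
move=> p; rewrite /ore_mul -[RHS]coefK poly_def.
by apply: eq_bigr => i _; rewrite iter_ore_shift1.
Qed.


HB.instance Definition _ := GRing.Lmodule.copy (ore delta) {poly R}.
HB.instance Definition _ := GRing.Zmodule_isNzRing.Build (ore delta)
  ore_mulA ore_mul1l ore_mul1r ore_mulDl ore_mulDr (oner_neq0 {poly R}).
HB.instance Definition _ := GRing.Lmodule_isLalgebra.Build R (ore delta)
  (fun a p q => esym (ore_mulZl a p q)).

Definition ore_t : ore delta := ('X : {poly R}).

Definition ore_coef (f : ore delta) (n : nat) : R := (f : {poly R})`_n.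

Lemma ore_tMl (f : ore delta) : ore_t * f = ore_shift f.
Proof.
change (ore_mul 'X f = ore_shift f).
rewrite /ore_mul size_polyX !big_ord_recl big_ord0 !coefX /=.
by rewrite scale0r add0r scale1r addr0.
Qed.

Lemma ore_tXE n : ore_t ^+ n = ('X^n : {poly R}).
Proof.
rewrite -iter_ore_shift1; elim: n => // n IH.
by rewrite exprS IH ore_tMl.
Qed.

Lemma ore_comm (r : R) : ore_t * r%:A = sigma r *: ore_t + (delta r)%:A.
Proof.
rewrite ore_tMl; change (ore_shift (r *: 1) = sigma r *: 'X + delta r *: 1).
by rewrite ore_shiftZ -[ore_shift 1]/(iter 1 ore_shift 1) iter_ore_shift1 expr1.
Qed.

Lemma ore_coef_basis (n : nat) (a : 'I_n -> R) (i : 'I_n) :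
  ore_coef (\sum_(j < n) a j *: ore_t ^+ j) i = a i.
Proof.
under eq_bigr do rewrite ore_tXE.
rewrite /ore_coef (coef_sum _ _ (fun j : 'I_n => a j *: 'X^j : {poly R})).
rewrite (bigD1 i) //= coefZ coefXn eqxx mulr1 big1 ?addr0 // => j ne_ji.
by rewrite coefZ coefXn eq_sym (inj_eq val_inj) (negPf ne_ji) mulr0.
Qed.

Lemma ore_coefK (f : ore delta) :
  exists n, f = \sum_(i < n) ore_coef f i *: ore_t ^+ i.
Proof.
exists (size (f : {poly R})); under eq_bigr do rewrite ore_tXE.
by rewrite -[LHS](@coefK R f) poly_def.
Qed.

Definition monic_of_degree (n : nat) (f : ore delta) : Prop :=
  exists a : 'I_n -> R, f = ore_t ^+ n + \sum_(i < n) a i *: ore_t ^+ i.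

Definition ore_grading (G : groupType) (gamma : G) (comp : G -> set R)
    (alpha : G) : set (ore delta) :=
  [set f | forall n, comp (alpha * gamma ^- n)%g (ore_coef f n)].

End OreExtension.

(* Main.v *)
Require Import Defs.
From HB Require Import structures.
From mathcomp Require Import all_boot all_order all_algebra.
From mathcomp Require Import boolp classical_sets.

Set Implicit Arguments.
Unset Strict Implicit.
Unset Printing Implicit Defensive.

Import GRing.Theory.
Local Open Scope ring_scope.
Local Open Scope classical_set_scope.

(** Write A for the Ore extension.  A graded ideal contains the homogeneous
    components of its elements, and conversely an ideal with this property is
    generated by its homogeneous elements; this is what makes gradings usable
    below ([graded_ideal_component], [component_graded_ideal]).

    If f is homogeneous, normal and monic of positive degree, then A f is a
    graded ideal; it is proper because multiplying by a monic element adds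
    degrees even when R has zero divisors.  Conversely, let I be a nonzero
    graded ideal and n the least degree of a nonzero element of I.  The
    coefficients of t^n of the elements of I of degree at most n form an ideal
    of R (on the right because sigma is onto) stable under components, so by
    gr-simplicity of R some element of I is monic of degree n, and its
    component in degree gamma^n is homogeneous and still monic
    ([graded_ideal_minimal_monic]).  By minimality of n, an element of I of
    degree at most n is a left R-multiple of this f; applied to f r and to
    t f - f t this shows that f commutes with R and t up to twists, hence is
    normal ([minimal_monic_normal]).  If I is proper then n > 0, which completes
    the criterion for gr-simplicity.

    A normal f, monic of degree n, satisfies f r = sigma^n(r) f for
    r in R, by comparison of degrees.  If a is the coefficient of t^(n-1) in f,
    then the coefficients of t^(n-1) on both sides express Delta_n as the inner
    derivation attached to - a ([normal_monic_Delta_inner]).  So if every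
    Delta_n is outer, the criterion applies.

    Now let R have characteristic 0 and let sigma delta sigma^-1 - delta be
    inner.  If delta is inner, it is delta_u with u homogeneous of degree
    gamma, and t - u is a homogeneous normal element because
    (t - u) r = sigma(r) (t - u).  Conversely, if A is not gr-simple then some
    Delta_n is inner; since each sigma^j delta sigma^-j differs from delta by
    an inner derivation, n delta is inner, and n is invertible in R because it
    generates a nonzero graded ideal. *)

(** * Homogeneous components and graded ideals *)

Section Components.
Variables (G : groupType) (S : nzRingType) (comp : G -> set S).
Hypothesis comp_gr : is_grading comp.

Lemma gr0 g : comp g 0.
Proof. by case: (gr_zmod comp_gr g). Qed.

Lemma grB g x y : comp g x -> comp g y -> comp g (x - y).
Proof. by case: (gr_zmod comp_gr g) => _; apply. Qed.

Lemma grD g x y : comp g x -> comp g y -> comp g (x + y).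
Proof.
move=> Cx Cy; rewrite -[y]opprK -[- y]sub0r.
by do !apply: grB => //; apply: gr0.
Qed.

Lemma gr_sum g I (r : seq I) (F : I -> S) :
  (forall i, comp g (F i)) -> comp g (\sum_(i <- r) F i).
Proof.
by move=> CF; elim/big_rec: _ => [|i x _]; [apply: gr0 | apply: grD].
Qed.

Definition is_decomposition (x : S) (sF : seq G * (G -> S)) : Prop :=
  [/\ uniq sF.1, forall g, comp g (sF.2 g),
      forall g, g \notin sF.1 -> sF.2 g = 0 & x = \sum_(g <- sF.1) sF.2 g].

Lemma decomposition_exists x : exists sF, is_decomposition x sF.
Proof.
have [s [f [Cf ->]]] := gr_span comp_gr x.
exists (undup s, fun g => f g *+ count_mem g s); split => /=.
- exact: undup_uniq.
- move=> g; elim: (count_mem g s) => [|k IH]; first exact: gr0.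
  by rewrite mulrS; apply: grD.
- by move=> g; rewrite mem_undup => /count_memPn ->.
rewrite -big_undup_iterop_count; apply: eq_bigr => g _.
by rewrite Monoid.iteropE iter_addr_0.
Qed.

Definition gr_support x := (projT1 (cid (decomposition_exists x))).1.
Definition component x := (projT1 (cid (decomposition_exists x))).2.

Lemma component_decomposition x :
  is_decomposition x (gr_support x, component x).
Proof.
by rewrite /gr_support /component; case: (cid _) => -[s F].
Qed.

Lemma gr_component x g : comp g (component x g).
Proof. by case: (component_decomposition x). Qed.

Lemma gr_supportPn x g : g \notin gr_support x -> component x g = 0.
Proof. by case: (component_decomposition x) => _ _ + _; apply. Qed.

(** Two decompositions are compared by summing both over a common list. *)
Lemma sum_over_superset (s s' : seq G) (F : G -> S) :
  uniq s -> uniq s' -> {subset s <= s'} -> (forall g, g \notin s -> F g = 0) ->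
  \sum_(g <- s') F g = \sum_(g <- s) F g.
Proof.
move=> Us Us' sub F0; rewrite (bigID (mem s)) /= [X in _ + X]big1; last first.
  by move=> g /F0.
rewrite addr0 -big_filter.
apply/perm_big/uniq_perm; rewrite ?filter_uniq // => g.
by rewrite mem_filter; case sg: (g \in s) => //=; rewrite sub.
Qed.

Lemma sum_component x s : uniq s -> {subset gr_support x <= s} ->
  \sum_(g <- s) component x g = x.
Proof.
have [/= U _ F0 eq_x] := component_decomposition x.
by move=> Us sub; rewrite (sum_over_superset U Us sub F0) -eq_x.
Qed.

Lemma sum_support x : \sum_(g <- gr_support x) component x g = x.
Proof. by apply: sum_component => //; case: (component_decomposition x). Qed.

Lemma component_unique x (s : seq G) (F : G -> S) :
  uniq s -> (forall g, comp g (F g)) -> (forall g, g \notin s -> F g = 0) ->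
  x = \sum_(g <- s) F g -> component x = F.
Proof.
move=> Us CF F0 def_x; apply/funext => g.
pose s' := undup (s ++ gr_support x).
have Us' : uniq s' by rewrite undup_uniq.
have sub1 : {subset s <= s'} by move=> h hs; rewrite mem_undup mem_cat hs.
have sub2 : {subset gr_support x <= s'}.
  by move=> h hs; rewrite mem_undup mem_cat hs orbT.
have dif0 : \sum_(h <- s') (component x h - F h) = 0.
  rewrite sumrB (sum_component Us' sub2) (sum_over_superset Us Us' sub1 F0).
  by rewrite -def_x subrr.
have [gs'|] := boolP (g \in s').
  apply/eqP; rewrite -subr_eq0; apply/eqP; move: gs'.
  apply: (gr_indep comp_gr Us' _ dif0) => h.
  by apply: grB => //; apply: gr_component.
rewrite mem_undup mem_cat negb_or => /andP[/F0 -> gx].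
by rewrite gr_supportPn.
Qed.

Lemma componentD x y g : component (x + y) g = component x g + component y g.
Proof.
pose s := undup (gr_support x ++ gr_support y).
rewrite (@component_unique _ s (fun h => component x h + component y h)) //.
- exact: undup_uniq.
- by move=> h; apply: grD; apply: gr_component.
- move=> h; rewrite mem_undup mem_cat negb_or => /andP[hx hy].
  by rewrite !gr_supportPn // addr0.
by rewrite big_split /= !sum_component ?undup_uniq // => h hs;
  rewrite mem_undup mem_cat hs ?orbT.
Qed.

Lemma component0 g : component 0 g = 0.
Proof. by apply: (addIr (component 0 g)); rewrite -componentD !add0r. Qed.

Lemma componentN x g : component (- x) g = - component x g.
Proof.
by apply: (addrI (component x g)); rewrite -componentD !subrr component0.
Qed.

Lemma component_sum I (r : seq I) (F : I -> S) g :
  component (\sum_(i <- r) F i) g = \sum_(i <- r) component (F i) g.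
Proof.
apply: (big_morph (component^~ g)) => [x y|]; first exact: componentD.
exact: component0.
Qed.

Lemma component_homE h x g :
  comp h x -> component x g = if g == h then x else 0.
Proof.
move=> Cx.
rewrite (@component_unique x [:: h] (fun g => if g == h then x else 0)) //=.
- by move=> k; case: eqP => [->|_] //; apply: gr0.
- by move=> k; rewrite inE => /negPf ->.
by rewrite big_seq1 eqxx.
Qed.

Lemma component_hom h x : comp h x -> component x h = x.
Proof. by move/component_homE ->; rewrite eqxx. Qed.

Lemma component_homMl h a x g : comp h a ->
  component (a * x) g = a * component x (h^-1 * g)%g.
Proof.
move=> Ca; have [/= U _ F0 eq_x] := component_decomposition x.
rewrite (@component_unique _ [seq (h * k)%g | k <- gr_support x]
  (fun g => a * component x (h^-1 * g)%g)) //.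
- by rewrite map_inj_uniq //; apply: mulgI.
- move=> k; rewrite -{1}[k](mulVKg h).
  by apply: gr_mul => //; apply: gr_component.
- move=> k kn; rewrite gr_supportPn ?mulr0 //; apply: contra kn => kx.
  by apply/mapP; exists (h^-1 * k)%g; rewrite // mulVKg.
rewrite big_map {1}eq_x mulr_sumr; apply: eq_bigr => k _.
by rewrite mulKg.
Qed.

Lemma component_homMr h b x g : comp h b ->
  component (x * b) g = component x (g * h^-1)%g * b.
Proof.
move=> Cb; have [/= U _ F0 eq_x] := component_decomposition x.
rewrite (@component_unique _ [seq (k * h)%g | k <- gr_support x]
  (fun g => component x (g * h^-1)%g * b)) //.
- by rewrite map_inj_uniq //; apply: mulIg.
- move=> k; rewrite -{1}[k](mulgVK h).
  by apply: gr_mul => //; apply: gr_component.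
- move=> k kn; rewrite gr_supportPn ?mul0r //; apply: contra kn => kx.
  by apply/mapP; exists (k * h^-1)%g; rewrite // mulgVK.
rewrite big_map {1}eq_x mulr_suml; apply: eq_bigr => k _.
by rewrite mulgK.
Qed.

(** The component e of 1 in degree 1 is a right unit on homogeneous elements:
    for x of degree g, x * e is the component of degree g of x * 1.  Hence e is
    a right unit everywhere, and 1 = 1 * e = e. *)
Lemma gr1 : comp 1%g 1.
Proof.
pose e := component 1 1%g.
have idem x : x * e = x.
  rewrite -[in RHS](sum_support x) -[in LHS](sum_support x) mulr_suml.
  apply: eq_bigr => g _; have Cx := gr_component x g.
  rewrite -[RHS](component_hom Cx) -[in RHS](mulr1 (component x g)).
  by rewrite (component_homMl _ _ Cx) mulVg.
by rewrite -(idem 1) mul1r; apply: gr_component.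
Qed.

Lemma two_sided_smallest (X : set S) :
  two_sided_ideal (smallest (@two_sided_ideal S) X).
Proof.
split=> [I [[]]//|x y Ix Iy I II|a x Ix I II|a x Ix I II].
- by case: (II) => -[_ + _ _] _; apply; [apply: Ix | apply: Iy].
- by case: (II) => -[_ _ + _] _; apply; apply: Ix.
by case: (II) => -[_ _ _ +] _; apply; apply: Ix.
Qed.

Lemma graded_ideal_two_sided I : graded_ideal comp I -> two_sided_ideal I.
Proof. by case=> X _ ->; apply: two_sided_smallest. Qed.

Lemma ideal_add (I : set S) x y :
  two_sided_ideal I -> I x -> I y -> I (x + y).
Proof.
case=> I0 IB _ _ Ix Iy; rewrite -[y]opprK -[- y]sub0r.
by apply/IB/IB.
Qed.

Lemma ideal_sum (I : set S) J (r : seq J) (F : J -> S) :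
  two_sided_ideal I -> (forall i, I (F i)) -> I (\sum_(i <- r) F i).
Proof.
move=> II IF; elim/big_rec: _ => [|i x _ Ix]; first by case: II.
exact: ideal_add.
Qed.

(** The elements all of whose components lie in I form an ideal, and it
    contains the homogeneous generators of I. *)
Lemma graded_ideal_component I x g :
  graded_ideal comp I -> I x -> I (component x g).
Proof.
move=> I_gr; have II := graded_ideal_two_sided I_gr.
case: I_gr (II) => X homX defI [I0 IB Il Ir] Ix.
pose J := [set y | forall h, I (component y h)].
suff: J x by apply.
move: Ix; rewrite defI; apply: smallest_sub => [|y Xy].
  split=> [h|y z Jy Jz h|a y Jy h|a y Jy h] /=.
  - by rewrite component0.
  - by rewrite componentD componentN; apply: IB.
  - rewrite -[a]sum_support mulr_suml component_sum; apply: ideal_sum => // k.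
    by rewrite (component_homMl _ _ (gr_component a k)); apply/Il/Jy.
  rewrite -[a]sum_support mulr_sumr component_sum; apply: ideal_sum => // k.
  by rewrite (component_homMr _ _ (gr_component a k)); apply/Ir/Jy.
have [k Cy] := homX y Xy.
have Iy : I y by rewrite defI; apply: sub_gen_smallest.
by move=> h; rewrite (component_homE _ Cy); case: ifP.
Qed.

Lemma component_graded_ideal I : two_sided_ideal I ->
  (forall x g, I x -> I (component x g)) -> graded_ideal comp I.
Proof.
move=> II Icomp; exists (I `&` homogeneous comp) => [x []//|].
apply/seteqP; split; last by apply: smallest_sub => // x [].
move=> x Ix; rewrite -[x]sum_support.
apply: (ideal_sum _ (two_sided_smallest _)) => g.
apply: sub_gen_smallest; split; first exact: Icomp.
by exists g; apply: gr_component.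
Qed.

Lemma normal_ideal_two_sided (f : S) :
  normal_elt f -> two_sided_ideal (range (fun s => s * f)).
Proof.
move=> Nf; split=> [|_ _ [a _ <-] [b _ <-]|a _ [b _ <-]|b _ [a _ <-]].
- by exists 0; rewrite ?mul0r.
- by exists (a - b); rewrite ?mulrBl.
- by exists (a * b); rewrite ?mulrA.
have : range (fun s => f * s) (f * b) by exists b.
rewrite -Nf => -[c _ /= def_c]; exists (a * c) => //=.
by rewrite -!mulrA def_c.
Qed.

(** The graded ideal generated by a normal f is the set of its left
    multiples, so it is proper unless f has a left inverse. *)
Lemma gr_simple_normal_inv (f : S) :
  gr_simple comp -> homogeneous comp f -> normal_elt f -> f != 0 ->
  exists s, s * f = 1.
Proof.
move=> simple homf Nf nzf.
have Ff : range (fun s => s * f) f by exists 1; rewrite ?mul1r.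
have FI := normal_ideal_two_sided Nf.
have: graded_ideal comp (range (fun s => s * f)).
  exists [set f]; first by move=> _ ->.
  apply/seteqP; split; last by apply: smallest_sub => // _ ->.
  move=> _ [a _ <-]; have [_ _ + _] := two_sided_smallest [set f].
  by apply; apply: sub_gen_smallest.
case/simple => eqF; first by move: Ff; rewrite eqF => /eqP; rewrite (negPf nzf).
have: range (fun s => s * f) 1 by rewrite eqF.
by case=> s _ def1; exists s.
Qed.

(** A positive integer is homogeneous of degree 1 and central. *)
Lemma gr_simple_nat_inv n : gr_simple comp -> char0 S -> (0 < n)%N ->
  exists s : S, s * n%:R = 1 /\ forall r, s * r = r * s.
Proof.
move=> simple S0 n0; have comm_n (r : S) : r * n%:R = n%:R * r.
  by rewrite mulr_natr mulr_natl.
have [||s sn] := gr_simple_normal_inv simple (f := n%:R) _ _ (S0 n n0).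
- exists 1%g; elim: (n) => [|k IH]; first exact: gr0.
  by rewrite -addn1 natrD; apply: grD => //; apply: gr1.
- rewrite /normal_elt; suff -> : (fun r : S => r * n%:R) = *%R n%:R by [].
  exact/funext.
exists s; split=> // r.
have ns : n%:R * s = 1 by rewrite -comm_n.
rewrite -[LHS]mulr1 -[X in _ * X]ns -mulrA [r * _]mulrA comm_n.
by rewrite -[n%:R * r * s]mulrA mulrA sn mul1r.
Qed.

End Components.

(** * Coefficients, degrees and normality in an Ore extension *)

(** Degree bounds are expressed by the size of the underlying polynomial: a
    size of at most n.+1 is a degree of at most n. *)
Section OreCoefficients.
Variables (R : nzRingType) (sigma : {rmorphism R -> R}).
Variable delta : skew_derivation sigma.
Implicit Types f g : ore delta.

Local Notation t := (ore_t delta).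
Local Notation sz f := (size (f%R : {poly R})).

Lemma ore_coefP f g : (forall n, ore_coef f n = ore_coef g n) -> f = g.
Proof. by move=> eq_fg; apply/polyP. Qed.

Lemma ore_coef0 n : ore_coef (0 : ore delta) n = 0.
Proof. exact: coef0. Qed.

Lemma ore_coefD f g n : ore_coef (f + g) n = ore_coef f n + ore_coef g n.
Proof. exact: coefD. Qed.

Lemma ore_coefB f g n : ore_coef (f - g) n = ore_coef f n - ore_coef g n.
Proof. exact: coefB. Qed.

Lemma ore_coef_sum I (r : seq I) (F : I -> ore delta) n :
  ore_coef (\sum_(i <- r) F i) n = \sum_(i <- r) ore_coef (F i) n.
Proof.
elim/big_rec2: _ => [|i x y _ <-]; first exact: ore_coef0.
exact: ore_coefD.
Qed.

Lemma ore_coefZ a f n : ore_coef (a *: f) n = a * ore_coef f n.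
Proof. exact: coefZ. Qed.

Lemma ore_coefC a n :
  ore_coef (a%:A : ore delta) n = if n == 0 then a else 0.
Proof.
rewrite ore_coefZ [ore_coef 1 n](coefC (1 : R) n).
by case: ifP; rewrite ?mulr1 ?mulr0.
Qed.

Lemma ore_coef_tX i n : ore_coef (t ^+ i) n = (n == i)%:R.
Proof. by rewrite ore_tXE /ore_coef coefXn. Qed.

Lemma ore_sizeP f n :
  reflect (forall i, (n <= i)%N -> ore_coef f i = 0) (sz f <= n)%N.
Proof. exact: leq_sizeP. Qed.

Lemma ore_coef_default f n : (sz f <= n)%N -> ore_coef f n = 0.
Proof. exact: nth_default. Qed.

Lemma ore_sizeC a : (sz (a%:A : ore delta) <= 1)%N.
Proof. by apply/ore_sizeP => -[|i] // _; rewrite ore_coefC. Qed.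

Lemma ore_size0 f : (sz f <= 0)%N -> f = 0.
Proof.
move=> f0; apply: ore_coefP => n.
by rewrite ore_coef0 ore_coef_default // (leq_trans f0).
Qed.

Lemma ore_size1 f : (sz f <= 1)%N -> f = (ore_coef f 0)%:A.
Proof.
move=> f1; apply: ore_coefP => -[|n]; rewrite ore_coefC //.
by rewrite ore_coef_default // (leq_trans f1).
Qed.

Lemma size_iter_shift i (q : {poly R}) n :
  (size q <= n)%N -> (size (iter i (ore_shift delta) q) <= i + n)%N.
Proof.
move=> qn; elim: i => //= i IH; apply/leq_sizeP => -[//|k] le_k.
have lek : (i + n <= k)%N by [].
rewrite coef_ore_shift !(nth_default 0) ?raddf0 ?addr0 //.
  exact: leq_trans (leqW lek).
exact: leq_trans lek.
Qed.

Lemma coef_iter_shift_top i (q : {poly R}) n : (size q <= n.+1)%N ->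
  (iter i (ore_shift delta) q)`_(i + n) = iter i sigma q`_n.
Proof.
move=> qn; elim: i => //= i IH; rewrite addSn coef_ore_shift IH.
rewrite [X in delta X]nth_default ?raddf0 ?addr0 //.
by have := size_iter_shift i qn; rewrite addnS.
Qed.

(** In t^(i+1) r, a term in t^i arises from letting exactly one of the i+1
    factors t act on r by delta and the others by sigma. *)
Lemma coef_iter_shift_sub i r :
  (iter i.+1 (ore_shift delta) r%:P)`_i =
    \sum_(j < i.+1) iter j sigma (delta (iter (i - j) sigma r)).
Proof.
elim: i => [|i IH]; first by rewrite /= coef_ore_shift coefC add0r big_ord1.
rewrite iterS coef_ore_shift {}IH [RHS]big_ord_recl /= addrC; congr (_ + _).
  have := @coef_iter_shift_top i.+1 r%:P 0.
  by rewrite size_polyC addn0 coefC /= => -> //; case: eqP.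
by rewrite rmorph_sum.
Qed.

Lemma ore_mulE f g n : (sz f <= n)%N ->
  f * g = \sum_(i < n) ore_coef f i *: (iter i (ore_shift delta) g : ore delta).
Proof. exact: ore_mul_wide. Qed.

Lemma ore_mul_lead f g m n : (sz f <= m.+1)%N -> (sz g <= n.+1)%N ->
  ore_coef (f * g) (m + n) = ore_coef f m * iter m sigma (ore_coef g n).
Proof.
move=> fm gn; rewrite (ore_mulE _ fm) ore_coef_sum big_ord_recr.
rewrite big1 /= => [|i _].
  by rewrite add0r ore_coefZ /ore_coef coef_iter_shift_top.
rewrite ore_coefZ /ore_coef [X in _ * X]nth_default ?mulr0 //.
apply: leq_trans (size_iter_shift i gn) _.
by rewrite addnS ltn_add2r.
Qed.

Lemma ore_size_mul f g m n : (sz f <= m.+1)%N -> (sz g <= n.+1)%N ->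
  (sz (f * g) <= (m + n).+1)%N.
Proof.
move=> fm gn; apply/ore_sizeP => k lek.
rewrite (ore_mulE _ fm) ore_coef_sum big1 // => i _.
rewrite ore_coefZ /ore_coef [X in _ * X]nth_default ?mulr0 //.
apply: leq_trans (size_iter_shift i gn) (leq_trans _ lek).
by rewrite addnS ltnS leq_add2r -ltnS.
Qed.

Lemma monic_of_degreeP n f :
  monic_of_degree n f <-> (sz f <= n.+1)%N /\ ore_coef f n = 1.
Proof.
split=> [[a ->]|[fn f1]].
  have a0 k : (n <= k)%N -> ore_coef (\sum_(i < n) a i *: t ^+ i) k = 0.
    move=> nk; rewrite ore_coef_sum big1 // => i _.
    by rewrite ore_coefZ ore_coef_tX gtn_eqF ?mulr0 // (leq_trans _ nk).
  split; last by rewrite ore_coefD a0 // ore_coef_tX eqxx addr0.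
  apply/ore_sizeP => k nk; rewrite ore_coefD a0 ?(ltnW nk) //.
  by rewrite ore_coef_tX gtn_eqF ?addr0.
exists (fun i => ore_coef f i); apply: ore_coefP => k.
rewrite ore_coefD ore_coef_tX.
have [kn|nk|->] := ltngtP k n.
- by rewrite add0r (ore_coef_basis delta _ (Ordinal kn)).
- rewrite ore_coef_default ?(leq_trans fn) // ore_coef_sum.
  rewrite big1 ?addr0 // => i _.
  by rewrite ore_coefZ ore_coef_tX gtn_eqF ?mulr0 // (ltn_trans _ nk).
rewrite f1 ore_coef_sum big1 ?addr0 // => i _.
by rewrite ore_coefZ ore_coef_tX gtn_eqF ?mulr0.
Qed.

Lemma iter_sigma1 n : iter n sigma 1 = 1.
Proof. by elim: n => //= n ->; rewrite rmorph1. Qed.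

(** The leading coefficient of g survives in g * f, so there is no loss of
    degree even when R has zero divisors. *)
Lemma size_mul_monic n f g k : monic_of_degree n f ->
  (sz (g * f) <= k + n)%N -> (sz g <= k)%N.
Proof.
case/monic_of_degreeP=> fn f1 le_gf; rewrite leqNgt; apply/negP => lt_kg.
have [m sz_g] : exists m, sz g = m.+1 by case: (sz g) lt_kg => // m _; exists m.
have := @ore_mul_lead g f m n; rewrite sz_g f1 => /(_ (leqnn _) fn).
rewrite ore_coef_default; last first.
  by apply: (leq_trans le_gf); rewrite leq_add2r -ltnS -sz_g.
rewrite iter_sigma1 mulr1 => /esym/eqP; apply/negP.
have -> : m = (sz g).-1 by rewrite sz_g.
rewrite [X in X != 0]/(lead_coef (g : {poly R})).
by rewrite lead_coef_eq0 -size_poly_eq0 sz_g.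
Qed.

Lemma ore_commC r : t * r%:A = (sigma r)%:A * t + (delta r)%:A.
Proof. by rewrite ore_comm mulr_algl. Qed.

Lemma ore_algD a b : (a + b)%:A = a%:A + b%:A :> ore delta.
Proof. exact: scalerDl. Qed.

Lemma ore_algN a : (- a)%:A = - a%:A :> ore delta.
Proof. exact: scaleNr. Qed.

Lemma ore_algM a b : (a * b)%:A = a%:A * b%:A :> ore delta.
Proof. by rewrite mulr_algl scalerA. Qed.

(** A is generated as a ring by R and t - u; the shift by u allows for a new
    variable that is adapted to an inner delta. *)
Lemma ore_ind (P : ore delta -> Prop) (u : R) :
  (forall r, P r%:A) -> (forall f g, P f -> P g -> P (f + g)) ->
  (forall f g, P f -> P g -> P (f * g)) -> P (t - u%:A) -> forall f, P f.
Proof.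
move=> PC PD PM Pu f; have [n ->] := ore_coefK f.
have Pt : P t by rewrite -[t](subrK u%:A); apply: PD.
elim/big_rec: _ => [|i g _ Pg]; first by rewrite -(scale0r (1 : ore delta)).
apply: PD => //; rewrite -mulr_algl; apply: (PM) => //.
elim: (nat_of_ord i) => [|k IH]; last by rewrite exprS; apply: PM.
by rewrite expr0 -(scale1r (1 : ore delta)).
Qed.

(** The g such that g f is in f A and f g is in A f form a subring; it
    contains R and t - u. *)
Lemma semi_invariant_normal f (tau tauV : R -> R) (u c : R) :
  cancel tauV tau ->
  (forall r, f * r%:A = (tau r)%:A * f) ->
  (t - u%:A) * f = f * (t - u%:A) + c%:A * f ->
  normal_elt f.
Proof.
move=> tauVK fr ft.
have lr (g : ore delta) :
    (exists h, g * f = f * h) /\ (exists h, f * g = h * f).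
  move: g; apply: (@ore_ind _ u).
  - move=> r; split; last by exists (tau r)%:A.
    by exists (tauV r)%:A; rewrite fr tauVK.
  - move=> g1 g2 [[h1 e1] [k1 d1]] [[h2 e2] [k2 d2]]; split.
      by exists (h1 + h2); rewrite mulrDl mulrDr e1 e2.
    by exists (k1 + k2); rewrite mulrDl mulrDr d1 d2.
  - move=> g1 g2 [[h1 e1] [k1 d1]] [[h2 e2] [k2 d2]]; split.
      by exists (h1 * h2); rewrite -mulrA e2 mulrA e1 -mulrA.
    by exists (k1 * k2); rewrite mulrA d1 -mulrA d2 mulrA.
  split.
    exists ((t - u%:A) + (tauV c)%:A).
    by rewrite mulrDr fr tauVK.
  by exists ((t - u%:A) - c%:A); rewrite mulrBl ft addrK.
apply/seteqP; split=> _ [g _ <-].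
  by have [[h ->] _] := lr g; exists h.
by have [_ [h ->]] := lr g; exists h.
Qed.

End OreCoefficients.

(** * The grading of the Ore extension *)

Section OreGrading.
Variables (G : groupType) (gamma : G) (R : nzRingType) (comp : G -> set R).
Hypothesis comp_gr : is_grading comp.
Variables (sigma : {rmorphism R -> R}) (delta : skew_derivation sigma).
Hypothesis compat : compatible sigma gamma comp delta.

Local Notation Agr := (ore_grading gamma comp : G -> set (ore delta)).

Lemma ore_grading_scale g h a (f : ore delta) :
  comp g a -> Agr h f -> Agr (g * h)%g (a *: f).
Proof.
by move=> Ca Af n; rewrite ore_coefZ -mulgA; apply: (gr_mul comp_gr).
Qed.

Lemma ore_grading_shift g (f : ore delta) :
  Agr g f -> Agr (gamma * g)%g (ore_shift delta f).
Proof.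
move=> Af n; rewrite /ore_coef coef_ore_shift; apply: (grD comp_gr); last first.
  by have [_] := compat (Af n); rewrite mulgA.
case: n => [|n]; first exact: (gr0 comp_gr).
have [+ _] := compat (Af n).
by rewrite expgS invgM !mulgA.
Qed.

Lemma ore_grading_iter_shift i g (f : ore delta) :
  Agr g f -> Agr (gamma ^+ i * g)%g (iter i (ore_shift delta) f).
Proof.
move=> Af; elim: i => [|i IH]; first by rewrite expg0 mul1g.
by rewrite expgS -mulgA; apply: ore_grading_shift.
Qed.

(** Right translation by gamma^-i is injective on degrees.  Hence, for each
    i, a finite sum of elements of distinct degrees in A gives one in R on the
    coefficients of t^i. *)
Lemma ore_is_grading : is_grading Agr.
Proof.
split.
- move=> g; split=> [n|f h Af Ah n].
    by rewrite ore_coef0; apply: (gr0 comp_gr).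
  by rewrite ore_coefB; apply: (grB comp_gr).
- move=> f; pose n := size (f : {poly R}).
  pose degs i :=
    [seq (g * gamma ^+ i)%g | g <- gr_support comp_gr (ore_coef f i)].
  pose s := undup (flatten [seq degs i | i <- iota 0 n]).
  pose F a : ore delta :=
    \poly_(i < n) component comp_gr (ore_coef f i) (a * gamma ^- i)%g.
  have FE a i : ore_coef (F a) i =
      component comp_gr (ore_coef f i) (a * gamma ^- i)%g.
    rewrite [LHS]coef_poly; case: ltnP => // le_ni.
    by rewrite ore_coef_default // component0.
  exists s, F; split=> [a i|]; first by rewrite FE; apply: gr_component.
  apply: ore_coefP => i; rewrite ore_coef_sum.
  under eq_bigr do rewrite FE.
  rewrite -(big_map (fun a => (a * gamma ^- i)%g) xpredT
    (component comp_gr (ore_coef f i))).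
  have [le_ni|lt_in] := leqP n i.
    by rewrite ore_coef_default // big1 // => a _; rewrite component0.
  rewrite sum_component ?map_inj_uniq ?undup_uniq //; first exact: mulIg.
  move=> g gs; apply/mapP; exists (g * gamma ^+ i)%g; last by rewrite mulgK.
  rewrite mem_undup; apply/flatten_mapP; exists i; first by rewrite mem_iota.
  exact: map_f.
- move=> s F Us AF sum0 g gs; apply: ore_coefP => i; rewrite ore_coef0.
  have := @gr_indep _ _ _ comp_gr [seq (h * gamma ^- i)%g | h <- s]
    (fun h => ore_coef (F (h * gamma ^+ i)%g) i).
  move=> /(_ _ _ _ (g * gamma ^- i)%g); rewrite mulgVK; apply.
  + by rewrite map_inj_uniq //; apply: mulIg.
  + by move=> h; have := AF (h * gamma ^+ i)%g i; rewrite mulgK.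
  + rewrite big_map; under eq_bigr do rewrite mulgVK.
    by rewrite -ore_coef_sum sum0 ore_coef0.
  + exact: map_f.
move=> g h f q Af Aq; rewrite (ore_mulE _ (leqnn _)) => n.
rewrite ore_coef_sum; apply: (gr_sum comp_gr) => // i.
have := ore_grading_scale (Af i) (ore_grading_iter_shift i Aq).
by rewrite !mulgA mulgVK; apply.
Qed.

Lemma ore_coef_component (A_gr : is_grading Agr) (f : ore delta) g n :
  ore_coef (component A_gr f g) n =
    component comp_gr (ore_coef f n) (g * gamma ^- n)%g.
Proof.
have [/= U A F0 def_f] := component_decomposition A_gr f.
rewrite (@component_unique _ _ _ _ (ore_coef f n)
  [seq (h * gamma ^- n)%g | h <- gr_support A_gr f]
  (fun h => ore_coef (component A_gr f (h * gamma ^+ n)%g) n)) ?mulgVK //.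
- by rewrite map_inj_uniq //; apply: mulIg.
- by move=> h; have := A (h * gamma ^+ n)%g n; rewrite mulgK.
- move=> h hs; rewrite gr_supportPn ?ore_coef0 //; apply: contra hs => hs.
  by apply/mapP; exists (h * gamma ^+ n)%g; rewrite ?mulgK.
rewrite big_map {1}def_f ore_coef_sum.
by apply: eq_bigr => h _; rewrite mulgVK.
Qed.

End OreGrading.

(** * Normal monic elements and the derivations Delta *)

Section SkewDerivationConjugates.
Variables (R : nzRingType) (sigma : {rmorphism R -> R}).
Variable delta : skew_derivation sigma.
Variable sigmaV : R -> R.
Hypothesis sigmaVK : cancel sigmaV sigma.

Local Notation t := (ore_t delta).
Local Notation sz f := (size (f%R : {poly R})).

Lemma iter_sigmaVK n : cancel (iter n sigmaV) (iter n sigma).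
Proof. by elim: n => // n IH r; rewrite iterSr iterS sigmaVK. Qed.

Lemma iter_sigmaV_sub j m r :
  (j <= m)%N -> iter (m - j) sigma (iter m sigmaV r) = iter j sigmaV r.
Proof.
by move=> le_jm; rewrite -[in iter m _ _](subnK le_jm) iterD iter_sigmaVK.
Qed.

(** Conjugating the inner derivation of v by sigma gives that of sigma(v), so
    the hypothesis can be iterated. *)
Lemma conjugate_inner_shift :
  inner_der sigma (fun r => sigma (delta (sigmaV r)) - delta r) ->
  forall j, exists u, forall r,
    iter j sigma (delta (iter j sigmaV r)) = delta r + (u * r - sigma r * u).
Proof.
case=> v dv; elim=> [|j [u IH]].
  by exists 0 => r; rewrite mul0r mulr0 subr0 addr0.
exists (v + sigma u) => r; rewrite iterS iterSr IH rmorphD rmorphB !rmorphM.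
rewrite sigmaVK -[sigma (delta _)](subrK (delta r)) dv.
by rewrite mulrDl mulrDr opprD [in RHS]addrACA [RHS]addrA [X in _ = X + _]addrC.
Qed.

Lemma Delta_inner_shift :
  inner_der sigma (fun r => sigma (delta (sigmaV r)) - delta r) ->
  forall n, exists u, forall r,
    Delta sigma sigmaV delta n r = n%:R * delta r + (u * r - sigma r * u).
Proof.
move=> /conjugate_inner_shift shift; elim=> [|n [u IH]].
  by exists 0 => r; rewrite /Delta big_ord0 !mul0r mulr0 subr0 addr0.
have [v dv] := shift n.
exists (u + v) => r; rewrite /Delta big_ord_recr /= -/(Delta _ _ _ _ _) IH dv.
rewrite addrACA -natr1 !mulrDl mul1r mulrDr opprD.
by rewrite [X in _ = _ + X]addrACA.
Qed.

(** Normality gives f r = g f for some g in A; since f is monic, g has degree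
    0, and the coefficients of t^n determine it. *)
Lemma normal_monic_semi_invariant (f : ore delta) n :
  normal_elt f -> monic_of_degree n f ->
  forall r, f * r%:A = (iter n sigma r)%:A * f.
Proof.
move=> Nf monf r; have /monic_of_degreeP[fn f1] := monf.
have : range (fun g => g * f) (f * r%:A) by rewrite Nf; exists r%:A.
case=> g _ def_g.
have sz_fr : (sz (f * r%:A) <= 1 + n)%N.
  by rewrite add1n -[n]addn0; apply: ore_size_mul => //; apply: ore_sizeC.
have /ore_size1 g_const : (sz g <= 1)%N.
  by apply: (size_mul_monic monf); rewrite def_g.
suff -> : iter n sigma r = ore_coef g 0 by rewrite -g_const def_g.
have := ore_mul_lead fn (ore_sizeC delta r).
rewrite ore_coefC eqxx addn0 -def_g {1}g_const mulr_algl ore_coefZ f1.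
by rewrite mulr1 mul1r.
Qed.

Lemma ore_tXM n (f : ore delta) : t ^+ n * f = iter n (ore_shift delta) f.
Proof.
elim: n => [|n IH]; first by rewrite expr0 mul1r.
by rewrite exprS -mulrA IH ore_tMl.
Qed.

(** With n = m + 1, a the coefficient of t^m in f and r = sigma^m(s), the
    coefficients of t^m in f s = sigma^n(s) f give
    Delta_n(r) + a r = sigma(r) a. *)
Lemma normal_monic_Delta_inner (f : ore delta) n : (0 < n)%N ->
  normal_elt f -> monic_of_degree n f ->
  inner_der sigma (Delta sigma sigmaV delta n).
Proof.
case: n => // m _ Nf monf; have /monic_of_degreeP[fm f1] := monf.
pose h := f - t ^+ m.+1.
have hm : (sz h <= m.+1)%N.
  apply/ore_sizeP => k; rewrite leq_eqVlt => /predU1P[<-|lt_mk].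
    by rewrite ore_coefB f1 ore_coef_tX eqxx subrr.
  rewrite ore_coefB ore_coef_tX gtn_eqF // subr0.
  by rewrite ore_coef_default // (leq_trans fm).
have h_m : ore_coef h m = ore_coef f m.
  by rewrite ore_coefB ore_coef_tX ltn_eqF // subr0.
exists (- ore_coef f m) => r; pose s := iter m sigmaV r.
have := congr1 (fun g => ore_coef g m) (normal_monic_semi_invariant Nf monf s).
have {1}-> : f = t ^+ m.+1 + h by rewrite addrC subrK.
rewrite /= mulrDl ore_coefD ore_tXM -[X in ore_coef (h * _) X]addn0.
rewrite (ore_mul_lead hm (ore_sizeC delta s)) h_m ore_coefC eqxx iter_sigmaVK.
rewrite mulr_algl ore_coefZ.
have -> : (s%:A : ore delta) = s%:P by rewrite -[RHS]alg_polyC.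
rewrite /ore_coef coef_iter_shift_sub -/(ore_coef f m).
have -> : \sum_(j < m.+1) iter j sigma (delta (iter (m - j) sigma s)) =
          Delta sigma sigmaV delta m.+1 r.
  apply: eq_bigr => j _; congr (iter j sigma (delta _)).
  by apply: iter_sigmaV_sub; rewrite -ltnS.
by move/(canRL (addrK _)) ->; rewrite mulNr mulrN opprK addrC.
Qed.

End SkewDerivationConjugates.

(** * Elements of minimal degree in graded ideals *)

Section MinimalDegree.
Variables (R : nzRingType) (sigma : {rmorphism R -> R}).
Variable delta : skew_derivation sigma.
Variable sigmaV : R -> R.
Hypothesis sigmaVK : cancel sigmaV sigma.

Local Notation t := (ore_t delta).
Local Notation sz f := (size (f%R : {poly R})).

(** Subtracting a left R-multiple of f lowers the degree, so by minimality the
    elements of I of degree at most n are left R-multiples of f.  Both f r and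
    t f - f t are of this kind: the leading terms of t f and f t cancel. *)
Lemma minimal_monic_normal (I : set (ore delta)) f n :
  two_sided_ideal I -> I f -> monic_of_degree n f ->
  (forall h, I h -> (sz h <= n)%N -> h = 0) -> normal_elt f.
Proof.
move=> II If /monic_of_degreeP[fn f1] minI.
have [I0 IB Il Ir] := II.
have multiple (g : ore delta) : I g -> (sz g <= n.+1)%N ->
    g = (ore_coef g n)%:A * f.
  move=> Ig gn; apply/eqP; rewrite -subr_eq0; apply/eqP/minI.
    by apply: IB => //; apply: Il.
  apply/ore_sizeP => i; rewrite ore_coefB mulr_algl ore_coefZ.
  rewrite leq_eqVlt => /predU1P[<-|lt_ni]; first by rewrite f1 mulr1 subrr.
  rewrite (ore_coef_default (leq_trans gn lt_ni)).
  by rewrite (ore_coef_default (leq_trans fn lt_ni)) mulr0 subrr.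
pose c := ore_coef (t * f - f * t) n.
apply: (@semi_invariant_normal _ _ delta f (iter n sigma) (iter n sigmaV) 0 c).
- exact: iter_sigmaVK.
- move=> r; rewrite [LHS]multiple; first last.
  + by rewrite -[n]addn0; apply: ore_size_mul => //; apply: ore_sizeC.
  + exact: Ir.
  have := ore_mul_lead fn (ore_sizeC delta r).
  by rewrite addn0 f1 mul1r ore_coefC eqxx => ->.
rewrite scale0r subr0 addrC -[LHS](subrK (f * t)); congr (_ + _).
apply: multiple; first by apply: IB; [apply: Il | apply: Ir].
have t1 : (sz t <= 2)%N by rewrite size_polyX.
apply/ore_sizeP => i; rewrite ore_coefB leq_eqVlt => /predU1P[<-|lt_ni].
  have := ore_mul_lead t1 fn; rewrite f1 add1n => ->.
  have := ore_mul_lead fn t1; rewrite f1 addn1 => ->.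
  rewrite -(expr1 t) ore_coef_tX eqxx !mul1r.
  by rewrite (iter_sigma1 _ 1) iter_sigma1 subrr.
have := ore_size_mul t1 fn; have := ore_size_mul fn t1; rewrite addn1 add1n.
move=> s1 s2; rewrite (ore_coef_default (leq_trans s1 lt_ni)).
by rewrite (ore_coef_default (leq_trans s2 lt_ni)) subrr.
Qed.

Variables (G : groupType) (gamma : G) (comp : G -> set R).
Hypothesis comp_gr : is_grading comp.
Hypothesis compat : compatible sigma gamma comp delta.
Hypothesis R_simple : gr_simple comp.

Local Notation Agr := (ore_grading gamma comp : G -> set (ore delta)).

Lemma graded_ideal_minimal_monic (I : set (ore delta)) :
  graded_ideal Agr I -> I <> [set 0] ->
  exists n f, [/\ I f, homogeneous Agr f, monic_of_degree n f &
    forall h, I h -> (sz h <= n)%N -> h = 0].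
Proof.
move=> I_gr nzI; have A_gr := ore_is_grading comp_gr compat.
have II := graded_ideal_two_sided I_gr; have [I0 IB Il Ir] := II.
pose P k := `[< exists x : ore delta, [/\ I x, x != 0 & sz x = k] >].
have exP : exists k, P k.
  apply: contrapT => noP; apply: nzI; apply/seteqP; split=> [x Ix|_ -> //].
  apply/eqP/negPn/negP => nzx; apply: noP; exists (sz x).
  by apply/asboolP; exists x.
case: (ex_minnP exP) => k /asboolP[x [Ix nzx sz_x]] min_k.
case: k sz_x min_k => [/eqP|n sz_x min_n].
  by rewrite size_poly_eq0 (negPf nzx).
have minI (h : ore delta) : I h -> (sz h <= n)%N -> h = 0.
  move=> Ih hn; apply/eqP/negPn/negP => nzh.
  have : P (sz h) by apply/asboolP; exists h.
  by move/min_n; rewrite leqNgt ltnS hn.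
pose L := [set c | exists f : ore delta,
  [/\ I f, (sz f <= n.+1)%N & ore_coef f n = c]].
have L_ideal : two_sided_ideal L.
  split.
  - by exists 0; split; rewrite ?ore_coef0 ?size_poly0.
  - move=> _ _ [f [If fn <-]] [g [Ig gn <-]]; exists (f - g).
    split; [exact: IB | | exact: ore_coefB].
    apply/ore_sizeP => i lt_ni; rewrite ore_coefB.
    rewrite (ore_coef_default (leq_trans fn lt_ni)).
    by rewrite (ore_coef_default (leq_trans gn lt_ni)) subrr.
  - move=> a _ [f [If fn <-]]; exists (a%:A * f); split; first exact: Il.
      by rewrite -[n]add0n; apply: ore_size_mul => //; apply: ore_sizeC.
    by rewrite mulr_algl ore_coefZ.
  (* Moving a constant past t^n twists it by sigma^n. *)
  move=> a _ [f [If fn <-]]; exists (f * (iter n sigmaV a)%:A).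
  split; first exact: Ir.
    by rewrite -[n]addn0; apply: ore_size_mul => //; apply: ore_sizeC.
  have := ore_mul_lead fn (ore_sizeC delta (iter n sigmaV a)).
  by rewrite addn0 ore_coefC eqxx iter_sigmaVK.
have L_gr : graded_ideal comp L.
  apply: (component_graded_ideal (comp_gr := comp_gr) L_ideal).
  move=> _ g [f [If fn <-]].
  exists (component A_gr f (g * gamma ^+ n)%g).
  split; first exact: graded_ideal_component.
    apply/ore_sizeP => i le_ni.
    rewrite ore_coef_component (ore_coef_default (leq_trans fn le_ni)).
    exact: component0.
  by rewrite ore_coef_component mulgK.
have Lx : L (ore_coef x n) by exists x; split; rewrite ?sz_x.
have : L 1.
  case: (R_simple L_gr) => [L0|-> //]; move: Lx; rewrite L0 /=.
  have -> : n = (sz x).-1 by rewrite sz_x.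
  move/eqP; rewrite [X in X == 0]/(lead_coef (x : {poly R})).
  by rewrite lead_coef_eq0 (negPf nzx).
case=> f [If fn f1]; exists n, (component A_gr f (gamma ^+ n)%g); split.
- exact: graded_ideal_component.
- by exists (gamma ^+ n)%g; apply: gr_component.
- apply/monic_of_degreeP; split.
    apply/ore_sizeP => i le_ni.
    rewrite ore_coef_component (ore_coef_default (leq_trans fn le_ni)).
    exact: component0.
  by rewrite ore_coef_component mulgV f1 (component_hom _ (gr1 comp_gr)).
exact: minI.
Qed.

(** In degree 0 the minimal monic element is 1, and the ideal is A. *)
Lemma ore_gr_simple_iff :
  gr_simple Agr <->
  ~ exists f : ore delta, [/\ homogeneous Agr f, normal_elt f &
      exists2 n, (0 < n)%N & monic_of_degree n f].
Proof.
have A_gr := ore_is_grading comp_gr compat; split.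
  move=> simple [f [homf Nf [n n0 monf]]].
  have /monic_of_degreeP[fn f1] := monf.
  have nzf : f != 0.
    by apply: contra_eq_neq f1 => ->; rewrite ore_coef0 eq_sym oner_eq0.
  have [s sf] := gr_simple_normal_inv simple homf Nf nzf.
  have s0 : s = 0.
    apply/ore_size0/(size_mul_monic monf).
    by rewrite sf [X in (X <= _)%N](size_poly1 R).
  by move/eqP: sf; rewrite s0 mul0r eq_sym oner_eq0.
move=> noN I I_gr; have II := graded_ideal_two_sided I_gr.
have [->|nzI] := pselect (I = [set 0]); [by left | right].
have [n [f [If homf monf minI]]] := graded_ideal_minimal_monic I_gr nzI.
case: n monf minI => [|n] monf minI; last first.
  case: noN; exists f; split=> //; last by exists n.+1.
  exact: minimal_monic_normal minI.
have f1 : f = 1.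
  have /monic_of_degreeP[f0 f1] := monf.
  by rewrite (ore_size1 f0) f1 scale1r.
apply/seteqP; split=> // g _; rewrite -[g]mulr1 -f1.
by have [_ _ Il _] := II; apply: Il.
Qed.

(** Keeping only the part of degree gamma * tau of delta(r) = u r - sigma(r) u,
    for r of degree tau, leaves only the component of u of degree gamma in
    both terms. *)
Lemma inner_homogeneous : inner_der sigma delta ->
  exists2 u, comp gamma u & forall r, delta r = u * r - sigma r * u.
Proof.
case=> u du; pose v := component comp_gr u gamma.
exists v => [|r]; first exact: gr_component.
rewrite -(sum_support comp_gr r) !raddf_sum mulr_sumr mulr_suml -sumrB.
apply: eq_bigr => g _.
move: (component _ r g) (gr_component comp_gr r g) => s Cs.
have [Csig Cdel] := compat Cs.
rewrite -(component_hom comp_gr Cdel) du componentD componentN.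
rewrite (component_homMr _ _ _ Cs) mulgK (component_homMl _ _ _ Csig).
by rewrite !invgM invgK -!mulgA mulKg mulVg mulg1.
Qed.

(** With t' = t - u one has t' r = sigma(r) t', and A is generated by R and
    t', which commutes with itself. *)
Lemma inner_normal u : (forall r, delta r = u * r - sigma r * u) ->
  normal_elt (t - u%:A).
Proof.
move=> du; apply: (@semi_invariant_normal _ _ delta _ sigma sigmaV u 0) => //.
  move=> r; rewrite mulrBl ore_commC du ore_algD ore_algN !ore_algM.
  by rewrite mulrBr -addrA [X in _ + X]addrAC subrr sub0r.
by rewrite scale0r mul0r addr0.
Qed.

End MinimalDegree.

Theorem theorem2 (G : groupType) (gamma : G) (R : nzRingType)
    (comp : G -> set R) (comp_gr : is_grading comp)
    (sigma : {rmorphism R -> R}) (delta : skew_derivation sigma)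
    (compat : compatible sigma gamma comp delta)
    (R_simple : gr_simple comp)
    (sigmaV : R -> R) (sigmaK : cancel sigma sigmaV)
    (sigmaVK : cancel sigmaV sigma) :
  let Agr : G -> set (ore delta) := ore_grading gamma comp in
  [/\ gr_simple Agr <->
        ~ (exists f : ore delta, [/\ homogeneous Agr f, normal_elt f &
             exists2 n : nat, (0 < n)%N & monic_of_degree n f]),
      (forall n : nat, (0 < n)%N -> outer_der sigma (Delta sigma sigmaV delta n)) ->
        gr_simple Agr
    & char0 R ->
      inner_der sigma (fun r => sigma (delta (sigmaV r)) - delta r) ->
      (gr_simple Agr <-> outer_der sigma delta)].
Proof.
move=> Agr; have simpleP := ore_gr_simple_iff sigmaVK comp_gr compat R_simple.
split=> // [outer|R0 conj_inner].
  apply/simpleP => -[f [_ Nf [n n0 monf]]].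
  exact: (outer n n0 (normal_monic_Delta_inner sigmaVK n0 Nf monf)).
split=> [/simpleP noN inner|outer].
  have [u Cu du] := inner_homogeneous comp_gr compat inner.
  apply: noN; exists (ore_t delta - u%:A); split.
  - exists gamma => i.
    rewrite ore_coefB -(expr1 (ore_t delta)) ore_coef_tX ore_coefC.
    case: i => [|[|i]].
    + rewrite sub0r expg0 invg1 mulg1 -sub0r.
      by apply: (grB comp_gr) => //; apply: (gr0 comp_gr).
    + by rewrite subr0 expg1 mulgV; apply: gr1.
    by rewrite subr0; apply: (gr0 comp_gr).
  - exact: inner_normal sigmaVK _ du.
  exists 1%N => //; exists (fun=> - u).
  by rewrite expr1 big_ord1 expr0 ore_algN.
apply/simpleP => -[f [_ Nf [n n0 monf]]]; apply: outer.
have [u du] := normal_monic_Delta_inner sigmaVK n0 Nf monf.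
have [v dv] := Delta_inner_shift sigmaVK conj_inner n.
have [s [sn sC]] := gr_simple_nat_inv comp_gr R_simple R0 n0.
(* s is the inverse of n; being central it can be absorbed into the element. *)
exists (s * (u - v)) => r.
have : n%:R * delta r = (u - v) * r - sigma r * (u - v).
  apply: (addIr (v * r - sigma r * v)); rewrite -dv du -[in LHS](subrK v u).
  by rewrite [in LHS]mulrDl [in LHS]mulrDr opprD addrACA.
move/(congr1 ( *%R s)); rewrite mulrA sn mul1r mulrBr => ->.
by rewrite !mulrA -(sC (sigma r)).
Qed.
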